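(* Let $q$ be a prime power, let $n$ be a positive integer, and let $\Delta$ be an $n\times n$ diagonal matrix over $\mathbb{F}_q$ with $n$ distinct diagonal entries, viewed as a linear operator on $\mathbb{F}_q^n$. For every integer partition $\mu=(\mu_1,\dots,\mu_k)$ (with positive parts), the number $\sigma_n(\mu)$ of subspaces of $\mathbb{F}_q^n$ with $\Delta$-profile $\mu$ is $$\sigma_n(\mu)=\binom{n}{|\mu|}(q-1)^{\sum_{j\ge 2}\mu_j}\,q^{\sum_{j\ge 2}\binom{\mu_j}{2}}\,b_{\mu'}(q),$$ where $|\mu|=\mu_1+\dots+\mu_k$ and $\mu'$ is the conjugate partition of $\mu$.
   Context: A subspace $W\subseteq\mathbb{F}_q^n$ has partial $\Delta$-profile $\mu=(\mu_1,\dots,\mu_k)$ if $\dim(W+\Delta W+\dots+\Delta^{j-1}W)=\mu_1+\dots+\mu_j$ for $1\le j\le k$; it has $\Delta$-profile $\mu$ if in addition $\dim(W+\Delta W+\dots+\Delta^{k-1}W)=\dim(W+\Delta W+\dots+\Delta^{k}W)$. A standard tableau of shape $\lambda=(\lambda_1,\dots,\lambda_m)$ with $N=|\lambda|$ cells is a filling $T=(T_{ij})_{1\le i\le m,\,1\le j\le\lambda_i}$ of the Young diagram of $\lambda$ by $1,\dots,N$, each used once, with rows increasing left to right and columns increasing top to bottom. For such $T$, $1\le i\le m$ and $2\le j\le\lambda_i$, let $c_{ij}(T)=\#\{i'\ge i : \text{the cell }(i',j-1)\text{ exists and } T_{i',j-1}<T_{ij}\}$, and define $c_q(T)=\prod_{i=1}^m\prod_{j=2}^{\lambda_i}[c_{ij}(T)]_q$,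 where $[a]_q=1+q+\dots+q^{a-1}$. Finally $b_\lambda(q)=\sum_T c_q(T)$, the sum over all standard tableaux $T$ of shape $\lambda$. *)

(* Defs.v *)
From HB Require Import structures.
From mathcomp Require Import all_boot all_order all_algebra.

Set Implicit Arguments.
Unset Strict Implicit.
Unset Printing Implicit Defensive.

Import GRing.Theory.

(* Over a finite field, a subspace is stored as a matrix in canonical form,   *)
(* so that subspaces form a finite type and can be counted with #|_|.         *)
Section FiniteVspace.
Import VectorInternalTheory.
Variables (F : finFieldType) (vT : vectType F).
HB.instance Definition _ := [Countable of {vspace vT} by <:].
HB.instance Definition _ := [Finite of {vspace vT} by <:].
End FiniteVspace.

Section Profile.

Variables (F : finFieldType) (n : nat) (D : 'M[F]_n).

Implicit Types (W : {vspace 'cV[F]_n}) (mu : seq nat).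

(* W + D W + ... + D^(j-1) W, which is 0 for j = 0 *)
Definition krylov j W : {vspace 'cV[F]_n} :=
  (\sum_(i < j) (linfun (mulmx (D ^+ i)%R) @: W))%VS.

Definition has_partial_profile mu W : bool :=
  [forall j : 'I_(size mu), \dim (krylov j.+1 W) == sumn (take j.+1 mu)].

Definition has_profile mu W : bool :=
  has_partial_profile mu W &&
  (\dim (krylov (size mu) W) == \dim (krylov (size mu).+1 W)).

Definition sigma mu : nat := #|[set W : {vspace 'cV[F]_n} | has_profile mu W]|.

End Profile.

Definition is_partition (mu : seq nat) : bool :=
  sorted geq mu && all (fun p => 0 < p) mu.

Definition conj_part (mu : seq nat) : seq nat :=
  mkseq (fun j => count (fun p => j < p) mu) (head 0 mu).

Section Tableaux.

Variable lam : seq nat.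

(* Rows and columns are numbered from 0. *)
Notation cell := {i : 'I_(size lam) & 'I_(nth 0 lam i)}.

Definition row_of (c : cell) : nat := tag c.
Definition col_of (c : cell) : nat := tagged c.

(* Entries are numbered from 0 too: T c = v stands for the entry v + 1. Only  *)
(* comparisons between entries are used.                                      *)
Notation filling := {ffun cell -> 'I_(sumn lam)}.

Implicit Type T : filling.

Definition is_standard T : bool :=
  [&& [forall v : 'I_(sumn lam), #|[set c : cell | T c == v]| == 1],
      [forall c : cell, forall c' : cell,
         (row_of c == row_of c') && (col_of c < col_of c') ==> (T c < T c')]
    & [forall c : cell, forall c' : cell,
         (col_of c == col_of c') && (row_of c < row_of c') ==> (T c < T c')]].

Definition cstat T (c : cell) : nat :=
  #|[set c' : cell | [&& row_of c <= row_of c', (col_of c').+1 == col_of c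
                       & T c' < T c]]|.

Definition qnat (q a : nat) : nat := \sum_(i < a) q ^ i.

Definition cq (q : nat) T : nat :=
  \prod_(c : cell | 0 < col_of c) qnat q (cstat T c).

Definition b_poly (q : nat) : nat :=
  \sum_(T : filling | is_standard T) cq q T.

End Tableaux.

(* Main.v *)
Require Import Defs.
From HB Require Import structures.
From mathcomp Require Import all_boot all_order all_algebra.
From mathcomp Require Import finfield zify.

Set Implicit Arguments.
Unset Strict Implicit.
Unset Printing Implicit Defensive.

Import GRing.Theory.

(* Write m = mu_1 and encode an m-dimensional W by an n x m matrix whose      *)
(* columns form a basis of W, i.e. by one vector v_i in F^m per diagonal      *)
(* entry a_i. Row rank being column rank, W + D W + ... + D^(j-1) W has the   *)
(* dimension of the span C_j of the (1, a_i, ..., a_i^(j-1)) (x) v_i. Now add *)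
(* the points (a_i, v_i) one at a time. For a new entry a, the operator       *)
(* x_l |-> x_(l+1) - a x_l maps C_(j+1) onto C_j with kernel                  *)
(* U_(j+1) = {v | (1, a, ..., a^j) (x) v in C_(j+1)}, so that                 *)
(* dim U_(j+1) = dim C_(j+1) - dim C_j is the current part nu_(j+1) of the    *)
(* profile. Hence exactly q^nu_(j-1) - q^nu_j vectors v increment nu_j, where *)
(* nu_0 = m, and only v = 0 leaves nu unchanged. Growing nu cell by cell up   *)
(* to mu traces a standard tableau of shape mu'; since                        *)
(* q^a - q^b = (q - 1) q^b [a - b]_q, the product of these weights is the     *)
(* summand of b_mu' times factors depending only on mu, those of the first    *)
(* column being |GL_m(F)|, the number of bases of W.                          *)

(** The whole argument is a double count. Pairs of a subspace W and an ordered basis of W number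
    sigma times |GL_m(F)| ([sigma_mul_card_unitmx], from [card_frames]), and [dim_krylov] reads such
    a basis as a labelling of the n diagonal entries by row vectors. The crux is [dim_absorbedS]:
    how many vectors at a new point raise a given part depends only on the current profile, not on
    the points.

    Labellings therefore obey a Pascal recursion, solved in [profile_countE]: binom(n, |mu|) chooses
    the points with nonzero vectors, and a weighted count of words records which part grows at each
    of them. [word_weightE] splits the weight of a word into |GL_m(F)|, powers of q - 1 and of q,
    and a ballot weight. By [sum_ballot_weight] the words of nonzero ballot weight are the standard
    tableaux of shape mu', and [cstat_before] identifies their factors with the [c_ij]_q. *)

Section Moments.
Variables (F : finFieldType) (m : nat).
Local Open Scope ring_scope.
Implicit Types (a : F) (v : 'rV[F]_m) (s : seq (F * 'rV[F]_m)).

Definition powers j a : 'cV[F]_j := \col_l a ^+ l.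

Definition moment_space j s : {vspace 'M[F]_(j, m)} :=
  <<[seq powers j p.1 *m p.2 | p <- s]>>%VS.

Definition moment_dim s j : nat := \dim (moment_space j s).

Definition increment s j : nat := (moment_dim s j.+1 - moment_dim s j)%N.

Definition absorbed j s a : {vspace 'rV[F]_m} :=
  (linfun (mulmx (powers j a)) @^-1: moment_space j s)%VS.

Lemma mem_absorbed j s a v :
  (v \in absorbed j s a) = (powers j a *m v \in moment_space j s).
Proof. by rewrite -memv_preim lfunE. Qed.

Lemma moment_dim0 s : moment_dim s 0 = 0%N.
Proof. by apply/eqP; rewrite -leqn0 (leq_trans (dimvS (subvf _))) // dimvf. Qed.

Lemma absorbed0 s a : absorbed 0 s a = fullv.
Proof.
apply/vspaceP => v; rewrite mem_absorbed memvf.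
by rewrite [X in X \in _](_ : _ = 0) ?mem0v //; apply/matrixP => - [].
Qed.

Definition shift_mx j a : 'M[F]_(j, j.+1) :=
  \matrix_(l, l') ((l' == l.+1 :> nat)%:R - a *+ (l' == l :> nat)).

Lemma shift_mxE j a p (x : 'M[F]_(j.+1, p)) l r :
  (shift_mx j a *m x) l r = x (lift ord0 l) r - a * x (widen_ord (leqnSn j) l) r.
Proof.
rewrite mxE (eq_bigr (fun l' => (l' == lift ord0 l)%:R * x l' r
   - (l' == widen_ord (leqnSn j) l)%:R * (a * x l' r))).
  rewrite sumrB; congr (_ - _).
    rewrite (bigD1 (lift ord0 l)) //= eqxx mul1r big1 ?addr0 // => i /negPf->.
    by rewrite mul0r.
  rewrite (bigD1 (widen_ord (leqnSn j) l)) //= eqxx mul1r big1 ?addr0 //.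
  by move=> i /negPf->; rewrite mul0r.
move=> i _; rewrite mxE -!val_eqE /= /bump /= add1n mulrBl; congr (_ - _).
by case: eqP; rewrite ?mulr1n ?mulr0n ?mul0r ?mul1r.
Qed.

Lemma shift_powers j a b v :
  shift_mx j a *m (powers j.+1 b *m v) = (b - a) *: (powers j b *m v).
Proof.
rewrite mulmxA scalemxAl; congr (_ *m v); apply/matrixP => l r.
by rewrite shift_mxE !mxE /= /bump /= add1n exprS -mulrBl.
Qed.

Lemma vline_scale (K : fieldType) (vT : vectType K) (c : K) (x : vT) :
  c != 0 -> (<[c *: x]> = <[x]>)%VS.
Proof.
move=> c0; apply/eqP; rewrite eqEsubv -!memvE memvZ ?memv_line //=.
by apply/vlineP; exists c^-1; rewrite scalerK.
Qed.

(** The shift multiplies the generator at b by b - a, which is nonzero because a is a new point. *)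
Lemma shift_moment_space j s a : a \notin map fst s ->
  (linfun (mulmx (shift_mx j a)) @: moment_space j.+1 s = moment_space j s)%VS.
Proof.
rewrite /moment_space; elim: s => [|[b v] s IHs] /=.
  by move=> _; rewrite !span_nil limg0.
rewrite inE negb_or => /andP[ab /IHs IH].
rewrite !span_cons limgD IH limg_line lfunE /= shift_powers.
by rewrite vline_scale // subr_eq0 eq_sym.
Qed.

(** Row 0 of the product is v itself. *)
Lemma powers_inj j a : lker (linfun (mulmx (powers j.+1 a) : 'rV_m -> _)) == 0%VS.
Proof.
apply/lker0P => u v; rewrite !lfunE /= => /matrixP eq_uv; apply/matrixP => i r.
by have := eq_uv ord0 r; rewrite !mxE !big_ord1 !mxE expr0 !mul1r (ord1 i).
Qed.

(* A sequence killed by the shift is geometric. *)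
Lemma lker_shift j a :
  lker (linfun (mulmx (shift_mx j a))) =
  limg (linfun (mulmx (powers j.+1 a) : 'rV_m -> _)).
Proof.
apply/vspaceP => x; rewrite memv_ker lfunE /=; apply/eqP/memv_imgP => [x0|[v _ ->]].
  exists (row ord0 x); rewrite ?memvf // lfunE /=; apply/matrixP => l r.
  rewrite mxE big_ord1 !mxE; case: l => l; elim: l => [|l IHl] lj.
    by rewrite mul1r; congr (x _ _); apply: val_inj.
  have /matrixP/(_ (Ordinal (lj : (l < j)%N)) r) := x0.
  rewrite shift_mxE mxE => /eqP; rewrite subr_eq0 => /eqP.
  rewrite [lift _ _](_ : _ = Ordinal lj); last exact: val_inj.
  move=> ->; rewrite [widen_ord _ _](_ : _ = Ordinal (ltnW lj)); last exact: val_inj.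
  by rewrite IHl /= exprS mulrA.
by rewrite lfunE /= shift_powers subrr scale0r.
Qed.

(** Rank-nullity for the shift on [moment_space j.+1 s]: by [lker_shift], its kernel there is a copy
    of the absorbed space. *)
Lemma dim_absorbed j s a : a \notin map fst s ->
  (\dim (absorbed j.+1 s a) + moment_dim s j)%N = moment_dim s j.+1.
Proof.
move=> a_s; rewrite /moment_dim -(shift_moment_space j a_s).
rewrite -(limg_ker_dim (linfun (mulmx (shift_mx j a)))); congr (_ + _)%N.
rewrite lker_shift -(limg_dim_eq (f := linfun (mulmx (powers j.+1 a)))).
  by rewrite /absorbed -lpreim_cap_limg lpreimK // capvSr.
by rewrite (eqP (powers_inj j a)) capv0.
Qed.

Lemma dim_absorbedS j s a : a \notin map fst s ->
  \dim (absorbed j.+1 s a) = increment s j.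
Proof. by move=> a_s; rewrite /increment -(dim_absorbed j a_s) addnK. Qed.

(** Forgetting the top power maps each moment space onto the previous one. Hence the subtraction in
    [increment] is exact and the absorbed spaces decrease with j. *)
Definition trunc_mx j : 'M[F]_(j, j.+1) := \matrix_(l, l') (l' == l :> nat)%:R.

Lemma trunc_powers j a v : trunc_mx j *m (powers j.+1 a *m v) = powers j a *m v.
Proof.
rewrite mulmxA; congr (_ *m v); apply/matrixP => l r; rewrite !mxE.
rewrite (bigD1 (widen_ord (leqnSn j) l)) //= !mxE eqxx mul1r big1 ?addr0 //.
by move=> i; rewrite -val_eqE /= !mxE => /negPf->; rewrite mul0r.
Qed.

Lemma trunc_moment_space j s :
  (linfun (mulmx (trunc_mx j)) @: moment_space j.+1 s = moment_space j s)%VS.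
Proof.
rewrite limg_span /moment_space -map_comp; congr <<_>>%VS.
by apply: eq_map => p /=; rewrite lfunE /= trunc_powers.
Qed.

Lemma moment_dim_leS s j : (moment_dim s j <= moment_dim s j.+1)%N.
Proof.
rewrite /moment_dim -trunc_moment_space.
by rewrite -(limg_ker_dim (linfun (mulmx (trunc_mx j))) (moment_space _ _)) leq_addl.
Qed.

Lemma moment_dimS s j : moment_dim s j.+1 = (moment_dim s j + increment s j)%N.
Proof. by rewrite subnKC ?moment_dim_leS. Qed.

Lemma absorbed_subS j s a : (absorbed j.+1 s a <= absorbed j s a)%VS.
Proof.
apply/subvP => v; rewrite !mem_absorbed => /(memv_img (linfun (mulmx (trunc_mx j)))).
by rewrite trunc_moment_space lfunE /= trunc_powers.
Qed.

Lemma absorbed_sub i j s a : (i <= j)%N -> (absorbed j s a <= absorbed i s a)%VS.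
Proof.
elim: j => [|j IHj]; first by case: i.
rewrite leq_eqVlt => /predU1P[-> // | /IHj]; apply: subv_trans; exact: absorbed_subS.
Qed.

Lemma dim_vline_add (K : fieldType) (vT : vectType K) (x : vT) (U : {vspace vT}) :
  \dim (<[x]> + U) = (\dim U + (x \notin U))%N.
Proof.
case: (boolP (x \in U)) => [xU|xU] /=.
  by rewrite addn0; congr (\dim _); apply/addv_idPr; rewrite -memvE.
rewrite dimv_disjoint_sum ?dim_vline; last first.
  apply/eqP; rewrite -subv0; apply/subvP => y /memv_capP[/vlineP[c ->]].
  have [->|c0 cxU] := eqVneq c 0; first by rewrite scale0r !mem0v.
  by case/negP: xU; rewrite -[x](scalerK c0) memvZ.
by rewrite addnC; case: eqP xU => // ->; rewrite mem0v.
Qed.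

Lemma moment_dim_cons a v s j :
  moment_dim ((a, v) :: s) j = (moment_dim s j + (v \notin absorbed j s a))%N.
Proof. by rewrite /moment_dim /moment_space /= span_cons dim_vline_add mem_absorbed. Qed.

(** Kept additive to avoid truncated subtraction. Since the absorbed spaces decrease, only the part
    at which v first escapes can grow. *)
Lemma increment_cons a v s j :
  (increment ((a, v) :: s) j + (v \notin absorbed j s a) =
   increment s j + (v \notin absorbed j.+1 s a))%N.
Proof.
have:= moment_dim_cons a v s j; have:= moment_dim_cons a v s j.+1.
rewrite !moment_dimS; lia.
Qed.

End Moments.

(** * Words and weighted growth paths *)

Lemma big_tuple_cons (T : finType) n (G : n.+1.-tuple T -> nat) :
  \sum_(t : n.+1.-tuple T) G t =
  \sum_(x : T) \sum_(t : n.-tuple T) G [tuple of x :: t].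
Proof.
rewrite pair_big /= (reindex (fun p : T * n.-tuple T => [tuple of p.1 :: p.2])) //.
exists (fun t => (thead t, [tuple of behead t])) => [[x t] _ | t _] /=.
  by congr (_, _); apply: val_inj.
by rewrite -tuple_eta.
Qed.

Section Words.

Variables (q m K : nat).
Implicit Types (f g nu : nat -> nat) (j : 'I_K) (w : seq 'I_K).

Definition agree f nu : bool := [forall j : 'I_K, f j == nu j].

Definition lower nu i0 : nat -> nat := fun i => nu i - (i == i0).

(** Parts are numbered from 0 here, so the convention nu_0 = m becomes the value at index 0. *)
Definition previous f i : nat := if i is i'.+1 then f i' else m.

Definition letter_weight f i : nat := q ^ previous f i - q ^ f i.

Definition content w i : nat := count (fun j : 'I_K => j == i :> nat) w.

(** The head is the letter added last, so its weight is taken at the content of the tail. *)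
Fixpoint word_weight w : nat :=
  if w is j :: w' then letter_weight (content w') j * word_weight w' else 1.

Fixpoint path_weight N nu : nat :=
  if N is N'.+1 then
    \sum_(j < K) (0 < nu j) *
      (letter_weight (lower nu j) j * path_weight N' (lower nu j))
  else agree (fun=> 0) nu.

Lemma agreeP f nu : reflect (forall i, i < K -> f i = nu i) (agree f nu).
Proof.
apply: (iffP forallP) => [fnu i iK | fnu j]; last by rewrite fnu.
by have /eqP := fnu (Ordinal iK).
Qed.

Lemma letter_weight_agree f g j : agree f g -> letter_weight f j = letter_weight g j.
Proof.
move=> /agreeP fg; rewrite /letter_weight fg //; congr (_ ^ _ - _).
by case: (nat_of_ord j) (ltn_ord j) => //= i /ltnW/fg.
Qed.

Lemma agree_incr f g nu j : (forall i, i < K -> g i = f i + (i == j)) ->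
  agree g nu = (0 < nu j) && agree f (lower nu j).
Proof.
move=> gf; apply/agreeP/andP => [gnu | [nu_j /agreeP fnu] i iK]; last first.
  by rewrite gf // fnu // /lower; case: eqP => [->|]; lia.
split; first by rewrite -gnu // gf // eqxx addn1.
by apply/agreeP => i iK; rewrite /lower -gnu // gf // addnK.
Qed.

Lemma path_weightE N nu :
  path_weight N nu = \sum_(w : N.-tuple 'I_K | agree (content w) nu) word_weight w.
Proof.
elim: N nu => [|N IHN] nu /=.
  rewrite big_mkcond (big_pred1 [tuple]) => [|w]; first by case: ifP.
  exact/esym/eqP/tuple0.
rewrite [RHS]big_mkcond /= [RHS]big_tuple_cons; apply: eq_bigr => j _ /=.
rewrite IHN !big_distrr [RHS]/= [in LHS]big_mkcond; apply: eq_bigr => w _.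
rewrite (@agree_incr (content w) _ nu j) => [|i _]; last first.
  by rewrite /content /= addnC eq_sym.
case: (0 < nu j) => //=; case: ifP => // /(letter_weight_agree j) ->.
by rewrite mul1n.
Qed.

End Words.

Arguments content : simpl never.

(** * Counting labellings by profile *)

Section Counting.

Variables (F : finFieldType) (m k : nat).
Let q := #|F|.
Let K := k.+1.
Implicit Types (s : seq (F * 'rV[F]_m)) (nu : nat -> nat).

Definition profile_count (x : seq F) nu : nat :=
  \sum_(t : (size x).-tuple 'rV[F]_m) agree K (increment (zip x t)) nu.

Lemma dim_absorbed_previous s a i : a \notin map fst s ->
  \dim (absorbed i s a) = previous m (increment s) i.
Proof.
move=> a_s; case: i => [|i] /=; last exact: dim_absorbedS.
by rewrite absorbed0 dimvf /dim /= mul1n.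
Qed.

Lemma card_absorbed s a i : a \notin map fst s ->
  \sum_(v : 'rV[F]_m) (v \in absorbed i s a) = q ^ previous m (increment s) i.
Proof.
move=> a_s; rewrite -(dim_absorbed_previous i a_s) -card_vspace.
by rewrite -sum1_card [RHS]big_mkcond /=; apply: eq_bigr => v _; case: (v \in _).
Qed.

Lemma card_first_escape s a i : a \notin map fst s ->
  \sum_(v : 'rV[F]_m) ((v \in absorbed i s a) && (v \notin absorbed i.+1 s a)) =
  letter_weight q m (increment s) i.
Proof.
move=> a_s; rewrite /letter_weight -(card_absorbed i a_s).
rewrite -[increment s i]/(previous m (increment s) i.+1).
rewrite -(card_absorbed i.+1 a_s) -sumnB => [|v _]; last first.
  by case: (boolP (v \in absorbed i.+1 s a)) => // /(subvP (absorbed_subS _ _ _)) ->.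
apply: eq_bigr => v _; case: (boolP (v \in absorbed i.+1 s a)) => [|_].
  by move/(subvP (absorbed_subS _ _ _)) ->.
by rewrite andbT subn0.
Qed.

(** Either v is absorbed at every level up to [K] and no part changes, or it escapes first at a
    unique level j and exactly part j grows by one. *)
Lemma agree_increment_cons a v s nu :
  agree K (increment ((a, v) :: s)) nu =
  (v \in absorbed K s a) * agree K (increment s) nu +
  \sum_(j < K) ((v \in absorbed j s a) && (v \notin absorbed j.+1 s a)) *
     ((0 < nu j) * agree K (increment s) (lower nu j)) :> nat.
Proof.
case: (boolP (v \in absorbed K s a)) => [vK | vK].
  have vi i : i <= K -> v \in absorbed i s a.
    by move=> iK; apply: (subvP (absorbed_sub _ _ iK)) vK.
  rewrite big1 => [|j _]; last by rewrite [v \in absorbed j.+1 s a]vi // andbF.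
  rewrite mul1n addn0; congr nat_of_bool; apply: eq_forallb => j.
  have := increment_cons a v s j; rewrite !vi //; last exact: ltnW.
  by rewrite !addn0 => ->.
have ex_i : exists i, v \notin absorbed i.+1 s a by exists k.
case: (ex_minnP ex_i) => i vi min_i.
have iK : i < K by apply: min_i.
(* Nestedness: v is absorbed exactly up to its first escape i. *)
have abs_i j : (v \in absorbed j s a) = (j <= i).
  apply/idP/idP => [|ji]; first apply: contraLR; last first.
    case: j ji => [_|j ji]; first by rewrite absorbed0 memvf.
    by apply: contraLR ji => /min_i; rewrite -ltnNge.
  rewrite -ltnNge => /(absorbed_sub s a)/subvP sub_j; apply: contra vi; exact: sub_j.
rewrite mul0n add0n (bigD1 (Ordinal iK)) //= !abs_i leqnn ltnn mul1n.
rewrite big1 ?addn0 => [|j]; last first.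
  rewrite -val_eqE /= !abs_i => ji; rewrite (_ : (_ && _) = false) //; lia.
rewrite (@agree_incr _ (increment s) _ _ (Ordinal iK)) ?mulnb // => j jK.
have := increment_cons a v s j; rewrite !abs_i /=; lia.
Qed.

Lemma map_fst_zip (x : seq F) (t : (size x).-tuple 'rV[F]_m) : map fst (zip x t) = x.
Proof. by rewrite -[LHS]/(unzip1 _) unzip1_zip // size_tuple. Qed.

Lemma profile_count_cons a x nu : a \notin x ->
  profile_count (a :: x) nu =
  q ^ nu k * profile_count x nu +
  \sum_(j < K) (0 < nu j) *
    (letter_weight q m (lower nu j) j * profile_count x (lower nu j)).
Proof.
move=> a_x; rewrite /profile_count big_tuple_cons exchange_big /= big_distrr /=.
under [X in _ = _ + X]eq_bigr => j _ do rewrite !big_distrr /=.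
rewrite [X in _ = _ + X]exchange_big -big_split; apply: eq_bigr => t _ /=.
have a_s : a \notin map fst (zip x t) by rewrite map_fst_zip.
under eq_bigr => v _ do rewrite agree_increment_cons.
rewrite big_split -big_distrl /= card_absorbed //; congr (_ + _).
  (* [previous] at [K] reads part k, which [agree] equates with [nu k]. *)
  by case: (boolP (agree K _ nu)) => [/agreeP/(_ k (ltnSn k)) <- | _]; rewrite ?muln0.
rewrite exchange_big; apply: eq_bigr => j _ /=.
rewrite -big_distrl /= card_first_escape //.
case: (0 < nu j); rewrite /= ?mul0n ?muln0 ?mul1n //.
by case: (boolP (agree K _ _)) => [/letter_weight_agree -> | _]; rewrite ?muln0.
Qed.

(** As [nu k = 0], the absorbed space at level [K] is zero: only v = 0 keeps the profile, with
    weight 1. The recursion in the points is then Pascal's rule. *)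
Lemma profile_countE x nu : uniq x -> nu k = 0 ->
  profile_count x nu =
  'C(size x, \sum_(j < K) nu j) * path_weight q m K (\sum_(j < K) nu j) nu.
Proof.
elim: x nu => [|a x IHx] nu.
  move=> _ _; rewrite /profile_count (big_pred1 [tuple]) => [|t]; last first.
    exact/esym/eqP/tuple0.
  rewrite bin0n.
  rewrite (_ : agree _ _ _ = agree K (fun=> 0) nu); last first.
    apply: eq_forallb => j.
    by rewrite /increment /moment_dim /moment_space /= !span_nil !dimv0.
  case: (posnP (\sum_(j < K) nu j)) => [-> | ]; first by rewrite mul1n.
  case: (boolP (agree _ _ _)) => [/agreeP nu0 | //].
  by rewrite big1 // => j _; rewrite -nu0.
move=> /andP[a_x ux] nuk; rewrite profile_count_cons // nuk mul1n IHx //.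
set M := \sum_(j < K) nu j.
have step (j : 'I_K) : 0 < nu j -> \sum_(i < K) lower nu j i = M.-1.
  move=> nuj; rewrite /M (bigD1 j) // [in RHS](bigD1 j) //= /lower eqxx.
  under eq_bigr => i ij do rewrite (negPf (ij : i != j :> nat)) subn0.
  by lia.
under eq_bigr => j _.
  rewrite (_ : _ * _ = 'C(size x, M.-1) * ((0 < nu j) * (letter_weight q m (lower nu j) j
    * path_weight q m K M.-1 (lower nu j)))); last first.
    case: (posnP (nu j)) => [_|nuj]; first by rewrite muln0.
    rewrite IHx //; last by rewrite /lower nuk.
    by rewrite step // !mul1n mulnCA.
  over.
rewrite -big_distrr /=; case M_eq : M => [|M'] /=.
  (* With nu = 0 no part can be lowered, so the sum vanishes. *)
  rewrite !bin0 big1 ?muln0 ?addn0 // => j _.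
  have /eqP := M_eq; rewrite /M sum_nat_eq0 => /forallP/(_ j)/eqP ->.
  by rewrite mul0n.
by rewrite binS mulnDl.
Qed.

End Counting.

(** * Column spaces, ranks and ordered bases *)

Section ColumnSpace.
Variable F : finFieldType.
Local Open Scope ring_scope.

Definition column_space n p (A : 'M[F]_(n, p)) : {vspace 'cV[F]_n} :=
  limg (linfun (mulmx A : 'cV_p -> 'cV_n)).

Lemma column_spaceM n p r (A : 'M[F]_(n, p)) (B : 'M[F]_(p, r)) :
  column_space (A *m B) = (linfun (mulmx A) @: column_space B)%VS.
Proof.
rewrite /column_space -limg_comp; congr (_ @: _)%VS.
by apply/lfunP => x; rewrite comp_lfunE !lfunE /= mulmxA.
Qed.

Lemma mem_column_space n p (A : 'M[F]_(n, p)) y :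
  y \in column_space A <-> exists x, y = A *m x.
Proof.
split=> [/memv_imgP[x _ ->] | [x ->]]; first by exists x; rewrite lfunE.
by apply/memv_imgP; exists x; rewrite ?memvf ?lfunE.
Qed.

Lemma column_space_row_free n p (A : 'M[F]_(n, p)) :
  row_free A -> column_space A = fullv.
Proof.
move=> fA; apply/vspaceP => y; rewrite memvf; apply/mem_column_space.
by exists (pinvmx A *m y); rewrite mulmxA mulmxVp ?mul1mx.
Qed.

Lemma dim_column_space n p (A : 'M[F]_(n, p)) : \dim (column_space A) = \rank A.
Proof.
rewrite -{1}[A]mulmx_base column_spaceM column_space_row_free ?row_base_free //.
rewrite limg_dim_eq ?dimvf ?/dim /= ?muln1 //.
apply/eqP; rewrite -subv0; apply/subvP => x /memv_capP[_].
rewrite memv_ker lfunE memv0 /= => /eqP Ax0.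
by rewrite -[x]mul1mx -(mulVpmx (col_base_full A)) -mulmxA Ax0 mulmx0.
Qed.

Lemma column_spaceE n p (A : 'M[F]_(n, p)) :
  column_space A = (\sum_(c < p) <[col c A]>)%VS.
Proof.
apply/eqP; rewrite eqEsubv; apply/andP; split; last first.
  apply/subv_sumP => c _; rewrite -memvE; apply/mem_column_space.
  by exists (delta_mx c 0); rewrite colE.
apply/subvP => _ /mem_column_space[x ->].
rewrite [A *m x](_ : _ = \sum_c x c 0 *: col c A).
  by apply: memv_sumr => c _; rewrite memvZ ?memv_line.
apply/matrixP => i z; rewrite !mxE summxE; apply: eq_bigr => c _.
by rewrite !mxE mulrC (ord1 z).
Qed.

Lemma dim_row_span n p (A : 'M[F]_(n, p)) :
  \dim (\sum_(i < n) <[row i A]>)%VS = \rank A.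
Proof.
rewrite -mxrank_tr -dim_column_space column_spaceE.
have tr_inj : lker (linfun (@trmx F 1 p)) == 0%VS.
  by apply/lker0P => x y; rewrite !lfunE /= => /trmx_inj.
rewrite -[LHS](limg_dim_eq (f := linfun (@trmx F 1 p))) ?(eqP tr_inj) ?capv0 //.
rewrite limg_sum; congr (\dim _); apply: eq_bigr => i _.
by rewrite limg_line lfunE /= tr_row.
Qed.

End ColumnSpace.

Section FrameCount.
Variables (F : finFieldType) (n : nat).
Local Open Scope ring_scope.

(** With one basis matrix [M0] of W fixed, every other is [M0 *m G] for a unique invertible G. *)
Lemma card_frames m (W : {vspace 'cV[F]_n}) : \dim W = m ->
  #|[set M : 'M[F]_(n, m) | column_space M == W]| =
  #|[set G : 'M[F]_m | G \in unitmx]|.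
Proof.
move=> <- {m}; set m := \dim W.
pose M0 : 'M[F]_(n, m) := \matrix_(i, r) ((vbasis W)`_r) i 0.
have M0W : column_space M0 = W.
  rewrite column_spaceE -[RHS](span_basis (vbasisP W)) span_def (big_nth 0).
  rewrite size_tuple big_mkord; apply: eq_bigr => r _; congr <[_]>%VS.
  by apply/matrixP => i z; rewrite !mxE (ord1 z).
have fM0 : row_full M0 by rewrite /row_full -dim_column_space M0W.
have M0K (p : nat) : cancel (mulmx M0 : 'M_(m, p) -> _) (mulmx (pinvmx M0)).
  by move=> X; rewrite mulmxA mulVpmx ?mul1mx.
rewrite -(card_imset _ (can_inj (M0K m))); apply: eq_card => M.
rewrite inE; apply/eqP/imsetP => [MW | [G]]; last first.
  rewrite inE -row_free_unit => fG ->.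
  by rewrite column_spaceM (column_space_row_free fG).
(* [pinvmx M0] is a left inverse of [M0]; it gives the coordinates of the columns of M. *)
have M_eq : M = M0 *m (pinvmx M0 *m M).
  suff eq_col c : col c M = col c (M0 *m (pinvmx M0 *m M)).
    apply/matrixP => i c; have /matrixP/(_ i 0) := eq_col c.
    by rewrite mxE => ->; rewrite mxE.
  rewrite [RHS]colE -(mulmxA M0) -(mulmxA (pinvmx M0)) -colE.
  have /mem_column_space[y ->] : col c M \in column_space M0.
    by rewrite M0W -MW; apply/mem_column_space; exists (delta_mx c 0); rewrite colE.
  by rewrite M0K.
exists (pinvmx M0 *m M) => //.
rewrite inE -row_full_unit /row_full eqn_leq rank_leq_row /=.
by rewrite (leq_trans _ (mxrankM_maxr M0 _)) // -M_eq -dim_column_space MW.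
Qed.

End FrameCount.

Lemma card_unitmx (F : finFieldType) m :
  #|[set G : 'M[F]_m | G \in unitmx]| = \prod_(i < m) (#|F| ^ m - #|F| ^ i).
Proof.
case: m => [|m].
  rewrite big_ord0 (_ : [set G : 'M[F]_0 | _] = [set 0%R]) ?cards1 //.
  apply/setP => G; rewrite !inE -row_full_unit /row_full.
  by rewrite [G]flatmx0 eqxx mxrank0.
have -> : #|[set G : 'M[F]_m.+1 | G \in unitmx]| = #|'GL_m.+1[F]%g|.
  by rewrite cardsT card_sub; apply: eq_card => G; rewrite !inE.
(* Spread q^C(m+1,2) as one factor q^i per term and use q^i (q^(m+1-i) - 1) = q^(m+1) - q^i. *)
rewrite card_GL // big_add1 /= big_mkord (reindex_inj rev_ord_inj) /=.
rewrite -bin2_sum big_mkord expn_sum -big_split /=.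
apply: eq_bigr => i _; rewrite mulnBr muln1 -expnD; congr (_ ^ _ - _).
by have := ltn_ord i; lia.
Qed.

(** * From subspaces to labelled diagonal entries *)

Section Profile.

Variables (F : finFieldType) (n m : nat) (D : 'M[F]_n).
Hypothesis D_diag : is_diag_mx D.
Local Open Scope ring_scope.
Implicit Types (M : 'M[F]_(n, m)) (mu : seq nat) (W : {vspace 'cV[F]_n}).

Definition labelled_rows M : seq (F * 'rV[F]_m) :=
  [seq (D i i, row i M) | i <- enum 'I_n].

Lemma diag_expE p (M : 'M[F]_(n, p)) l i r : (D ^+ l *m M) i r = D i i ^+ l * M i r.
Proof.
elim: l M i r => [|l IHl] M i r; first by rewrite expr0 mul1mx mul1r.
rewrite exprSr -mulmxE -mulmxA IHl exprSr -mulrA; congr (_ * _).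
rewrite mxE (bigD1 i) //= big1 ?addr0 // => i' ii'.
by rewrite (is_diag_mxP D_diag) ?mul0r // eq_sym.
Qed.

(** Row rank equals column rank for [A]: its columns are the D^l times columns of M, its rows the
    flattened moment generators. *)
Lemma dim_krylov M j :
  \dim (krylov D j (column_space M)) = moment_dim (labelled_rows M) j.
Proof.
pose A : 'M[F]_(n, j * m) := \matrix_i mxvec (powers j (D i i) *m row i M).
transitivity (\rank A).
  rewrite -dim_column_space [in RHS]column_spaceE; congr (\dim _).
  rewrite (reindex _ (curry_mxvec_bij j m)) /=.
  rewrite (eq_bigr (fun p => <[col (mxvec_index p.1 p.2) A]>%VS)) => [|[] //].
  rewrite -(pair_bigA _ (fun l r => <[col (mxvec_index l r) A]>%VS)).
  apply: eq_bigr => l _; rewrite -column_spaceM column_spaceE.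
  apply: eq_bigr => r _; congr <[_]>%VS; apply/matrixP => i z.
  by rewrite mxE diag_expE [in RHS]mxE [in RHS]mxE mxvecE mxE big_ord1 !mxE.
rewrite -dim_row_span /moment_dim /moment_space span_def big_map big_map big_enum /=.
have vec_inj : lker (linfun (@vec_mx F j m)) == 0%VS.
  by apply/lker0P => x y; rewrite !lfunE /= => /(can_inj vec_mxK).
rewrite -[LHS](limg_dim_eq (f := linfun (@vec_mx F j m))) ?(eqP vec_inj) ?capv0 //.
rewrite limg_sum; congr (\dim _); apply: eq_bigr => i _.
by rewrite limg_line lfunE /= rowK mxvecK.
Qed.

Lemma krylov1 W : krylov D 1 W = W.
Proof.
rewrite /krylov big_ord1 expr0 -[RHS]lim1g; congr (_ @: _)%VS.
by apply/lfunP => x; rewrite lfunE id_lfunE /= mul1mx.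
Qed.

Lemma has_profile_dim mu W : has_profile D mu W -> \dim W = nth 0%N mu 0.
Proof.
case/andP=> /forallP prof; rewrite -[in LHS](krylov1 W); case: mu prof => [|p mu] prof.
  by rewrite {1}/krylov big_ord0 dimv0 krylov1 => /eqP <-.
by have /eqP -> := prof ord0; rewrite /= take0 /= addn0.
Qed.

(** Stabilization of the chain is agreement at the extra index [size mu], where [nth] returns 0. *)
Lemma has_profileE mu M :
  has_profile D mu (column_space M) =
  agree (size mu).+1 (increment (labelled_rows M)) (nth 0%N mu).
Proof.
set s := labelled_rows M.
have takeS j : (j < size mu)%N -> sumn (take j.+1 mu) = (sumn (take j mu) + nth 0 mu j)%N.
  by move=> jk; rewrite (take_nth 0%N) // sumn_rcons.
apply/andP/agreeP => [[/forallP prof] | inc].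
  rewrite !dim_krylov -/s moment_dimS => /eqP prof_k.
  have dims j : (j <= size mu)%N -> moment_dim s j = sumn (take j mu).
    case: j => [|j] jk; first by rewrite moment_dim0 take0.
    by have /eqP := prof (Ordinal jk); rewrite dim_krylov.
  move=> j; rewrite ltnS leq_eqVlt => /predU1P[-> | jk].
    by rewrite nth_default //; lia.
  have := dims _ jk; rewrite moment_dimS dims ?takeS //; [lia | exact: ltnW].
have dims j : (j <= size mu)%N -> moment_dim s j = sumn (take j mu).
  elim: j => [|j IHj] jk; first by rewrite moment_dim0 take0.
  by rewrite moment_dimS IHj ?takeS ?inc //; lia.
split; first by apply/forallP => j; rewrite dim_krylov dims.
by rewrite !dim_krylov -/s moment_dimS inc // nth_default // addn0.
Qed.

End Profile.

Lemma profile_count_mx (F : finFieldType) n m k (D : 'M[F]_n) nu :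
  profile_count m k [seq D i i | i <- enum 'I_n] nu =
  \sum_(M : 'M[F]_(n, m)) agree k.+1 (increment (labelled_rows D M)) nu.
Proof.
have cast_count (x : seq F) p : size x = p -> profile_count m k x nu =
    \sum_(t : p.-tuple 'rV[F]_m) agree k.+1 (increment (zip x t)) nu.
  by move=> <-.
rewrite (cast_count _ n); last by rewrite size_map size_enum_ord.
rewrite (reindex (fun M : 'M[F]_(n, m) => [tuple row i M | i < n])) /=.
  by apply: eq_bigr => M _; rewrite /labelled_rows zip_map.
exists (fun t : n.-tuple 'rV[F]_m => (\matrix_i tnth t i)%R) => [M _ | t _].
  by apply/row_matrixP => i; rewrite rowK tnth_mktuple.
by apply: eq_from_tnth => i; rewrite tnth_mktuple rowK.
Qed.

(** Group the matrices M by column space; each W with profile mu arises from |GL_m(F)| of them. *)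
Lemma sigma_mul_card_unitmx (F : finFieldType) n (D : 'M[F]_n) mu (m := nth 0 mu 0) :
  is_diag_mx D ->
  sigma D mu * \prod_(i < m) (#|F| ^ m - #|F| ^ i) =
  profile_count m (size mu) [seq D i i | i <- enum 'I_n] (nth 0 mu).
Proof.
move=> D_diag; rewrite profile_count_mx.
rewrite (partition_big (fun M : 'M[F]_(n, m) => column_space M) predT) //=.
rewrite /sigma -sum1_card big_distrl /= big_mkcond; apply: eq_bigr => W _.
rewrite inE mul1n; case: ifP => profW.
  rewrite -card_unitmx -(card_frames (has_profile_dim profW)) -sum1_card.
  rewrite [LHS]big_mkcond [RHS]big_mkcond; apply: eq_bigr => M _; rewrite inE.
  by case: eqP => // MW; rewrite -has_profileE // MW profW.
by rewrite big1 // => M /eqP MW; rewrite -has_profileE // MW profW.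
Qed.

(** * Factorization of the word weight *)

Section Factorization.

Variables (q m K : nat).
Hypothesis q_gt0 : 0 < q.
Implicit Types w : seq 'I_K.

(* Truncated subtraction and [0]_q = 0 make the weight vanish on the words    *)
(* that do not come from a standard tableau.                                  *)
Fixpoint ballot_weight w : nat :=
  if w is j :: w' then
    (if 0 < j then qnat q (content w' j.-1 - content w' j) else 1) * ballot_weight w'
  else 1.

Lemma subn_exp_qnat a b : q ^ a - q ^ b = (q - 1) * q ^ b * qnat q (a - b).
Proof.
case: (leqP a b) => [ab | /ltnW ba].
  rewrite (eqP ab) /qnat big_ord0 muln0; apply/eqP.
  by rewrite subn_eq0 leq_pexp2l.
rewrite mulnAC subn1 -predn_exp -subn1 mulnBl mul1n -expnD subnK //.
Qed.

Lemma content_cons (j : 'I_K) w i : content (j :: w) i = (j == i :> nat) + content w i.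
Proof. by []. Qed.

(** By [subn_exp_qnat], adding a letter j > 0 at content c contributes (q - 1) q^c and a ballot
    factor; the exponents 0, 1, ... of one letter add up to a binomial. The letters 0 give the
    factors of |GL_m(F)|. *)
Lemma word_weightE w :
  word_weight q m w =
  \prod_(i < content w 0) (q ^ m - q ^ i) * (q - 1) ^ (\sum_(1 <= j < K) content w j)
  * q ^ (\sum_(1 <= j < K) 'C(content w j, 2)) * ballot_weight w.
Proof.
elim: w => [|j w IHw].
  by rewrite /content /= big_ord0 !big1.
rewrite [word_weight _ _ _]/= [ballot_weight _]/= IHw {IHw} /letter_weight.
rewrite (content_cons _ _ 0).
case: (posnP j) => [j0 | j_gt0].
  have same (G : nat -> nat) :
      \sum_(1 <= i < K) G (content (j :: w) i) = \sum_(1 <= i < K) G (content w i).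
    by apply: eq_big_nat => -[|i] // _; rewrite content_cons j0.
  rewrite (same id) (same (binomial^~ 2)) j0 add1n big_ord_recr /= mul1n.
  by rewrite !mulnA; congr (_ * _ * _ * _); rewrite mulnC.
rewrite add0n.
have jK : nat_of_ord j \in index_iota 1 K by rewrite mem_index_iota j_gt0 ltn_ord.
have same (G : nat -> nat) :
    \sum_(1 <= i < K | i != j) G (content (j :: w) i) =
    \sum_(1 <= i < K | i != j) G (content w i).
  by apply: eq_bigr => i ij; rewrite content_cons eq_sym (negPf ij).
rewrite !(bigD1_seq (nat_of_ord j) jK (iota_uniq _ _)) (same id) (same (binomial^~ 2)).
rewrite /= content_cons eqxx add1n addSn expnS binS bin1 !expnD.
rewrite [previous _ _ _](_ : _ = content w j.-1); last by case: (nat_of_ord j) j_gt0.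
by rewrite subn_exp_qnat; lia.
Qed.

End Factorization.

(** * Words read position by position *)

Section Positions.

Variables (K N : nat).
Implicit Type w : N.-tuple 'I_K.

(** Letters to the right of u were added earlier, so this is the content at the moment letter u is
    added. *)
Definition after w (u : 'I_N) i : nat :=
  #|[set u' : 'I_N | (u < u') && (tnth w u' == i :> nat)]|.

Lemma content_card w i : content w i = #|[set u : 'I_N | tnth w u == i :> nat]|.
Proof.
rewrite /content -sum1_count -sum1_card big_tuple.
by apply: eq_bigl => u; rewrite inE.
Qed.

Lemma content_drop w (u : 'I_N) i : content (drop u.+1 w) i = after w u i.
Proof.
have x0 : 'I_K := tnth w u.
transitivity (\sum_(u.+1 <= u' < N | nth x0 w u' == i :> nat) 1).
  rewrite /content -sum1_count (big_nth x0) size_drop size_tuple.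
  rewrite -[X in \sum_(X <= _ < N | _) _]add0n big_addn.
  by apply: eq_bigl => u'; rewrite nth_drop addnC.
rewrite big_geq_mkord /after -sum1_card; apply: eq_bigl => u'.
by rewrite inE andbC (tnth_nth x0).
Qed.

Lemma ballot_weight_prod q w :
  ballot_weight q w =
  \prod_(u < N) (if 0 < tnth w u then
    qnat q (after w u (tnth w u).-1 - after w u (tnth w u)) else 1).
Proof.
have -> (s : seq 'I_K) : ballot_weight q s =
  \prod_(0 <= u < size s) (if 0 < nth 0 (map val s) u then
     qnat q (content (drop u.+1 s) (nth 0 (map val s) u).-1
             - content (drop u.+1 s) (nth 0 (map val s) u)) else 1).
  by elim: s => [|j s IHs]; rewrite ?big_nil // big_nat_recl //= drop0 IHs.
rewrite size_tuple big_mkord; apply: eq_bigr => u _.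
by rewrite !content_drop (nth_map (tnth w u)) ?size_tuple // -tnth_nth.
Qed.

Lemma after_anti w (u u' : 'I_N) i : u <= u' -> after w u' i <= after w u i.
Proof.
move=> uu'; apply/subset_leq_card/subsetP => x; rewrite !inE => /andP[u'x ->].
by rewrite (leq_ltn_trans uu').
Qed.

Lemma lt_after w (u u' : 'I_N) i : after w u i < after w u' i -> u' < u.
Proof. by rewrite !ltnNge; apply/contra/after_anti. Qed.

Lemma after_lt w (u u' : 'I_N) i :
  tnth w u' = i :> nat -> u < u' -> after w u' i < after w u i.
Proof.
move=> wu' uu'; apply/proper_card/properP; split.
  apply/subsetP => x; rewrite !inE => /andP[u'x ->].
  by rewrite (ltn_trans uu').
by exists u'; rewrite !inE ?uu' ?wu' ?eqxx // ltnn.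
Qed.

Lemma after_lt_content w u : after w u (tnth w u) < content w (tnth w u).
Proof.
rewrite content_card; apply/proper_card/properP; split.
  by apply/subsetP => x; rewrite !inE => /andP[].
by exists u; rewrite !inE ?ltnn.
Qed.

End Positions.

(** * Words and standard tableaux *)

(** Both sides say that the cell in row r and column j lies in the diagram of mu'. *)
Lemma ltn_count_partition mu r j : sorted geq mu ->
  (j < count (fun p => r < p) mu) = (r < nth 0 mu j).
Proof.
elim: mu j => [|p mu IHmu] j; first by rewrite nth_nil.
move=> /= mu_sorted; have := IHmu^~ (path_sorted mu_sorted) => {}IHmu.
case: (leqP p r) => [pr | rp] /=; last first.
  by case: j => [|j]; rewrite ?rp //= add1n ltnS IHmu.
have geq_trans : transitive geq by move=> y x z /= xy yz; apply: leq_trans yz xy.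
have mu_le x : x \in mu -> x <= r.
  by move=> x_mu; apply: leq_trans pr; apply: (allP (order_path_min geq_trans mu_sorted)).
have -> : count (fun p => r < p) mu = 0.
  apply/eqP; rewrite -leqn0 leqNgt -has_count; apply/hasPn => x /mu_le.
  by rewrite leqNgt.
apply/esym/negbTE; rewrite -leqNgt; case: j => [|j] //=.
by case: (ltnP j (size mu)) => [/(mem_nth 0)/mu_le | /(nth_default 0) ->].
Qed.

Section Tableau.

Variable mu : seq nat.
Hypothesis mu_sorted : sorted geq mu.
Let lam := conj_part mu.
Let N := sumn lam.
Let K := (size mu).+1.
Notation cell := {i : 'I_(size lam) & 'I_(nth 0 lam i)}.
Notation filling := {ffun cell -> 'I_(sumn lam)}.
Implicit Types (c : cell) (T : filling) (w : N.-tuple 'I_K).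

Lemma nth_conj r : r < size lam -> nth 0 lam r = count (fun p => r < p) mu.
Proof. by rewrite size_mkseq => r_lt; rewrite nth_mkseq. Qed.

Lemma row_lt c : row_of c < nth 0 mu (col_of c).
Proof.
by rewrite -ltn_count_partition // -nth_conj ?ltn_ord // /col_of ltn_ord.
Qed.

Lemma col_lt c : col_of c < size mu.
Proof. by rewrite ltnNge; apply: contraTN (row_lt c) => ?; rewrite nth_default. Qed.

Lemma cell_inj c c' : row_of c = row_of c' -> col_of c = col_of c' -> c = c'.
Proof.
case: c c' => [i j] [i' j']; rewrite /row_of /col_of /= => /val_inj eq_i.
by case: _ / eq_i j' => j' /val_inj ->.
Qed.

Lemma cell_exists r j : r < nth 0 mu j -> {c : cell | row_of c = r & col_of c = j}.
Proof.
move=> r_lt; have r_lam : r < size lam.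
  rewrite size_mkseq -nth0 -ltn_count_partition //.
  by rewrite (leq_ltn_trans (leq0n j)) // ltn_count_partition.
have j_lt : j < nth 0 lam (Ordinal r_lam) by rewrite /= nth_conj // ltn_count_partition.
by exists (Tagged (fun i : 'I_(size lam) => 'I_(nth 0 lam i)) (Ordinal j_lt)).
Qed.

Lemma card_column r j : r <= nth 0 mu j ->
  #|[set c : cell | (col_of c == j) && (row_of c < r)]| = r.
Proof.
move=> r_le; pose f (i : 'I_r) := s2val (cell_exists (leq_trans (ltn_ord i) r_le)).
have f_row i : row_of (f i) = i by rewrite /f; case: cell_exists.
have f_col i : col_of (f i) = j by rewrite /f; case: cell_exists.
have f_inj : injective f.
  by move=> i i' /(congr1 (@row_of lam)); rewrite !f_row => /val_inj.
rewrite -[RHS]card_ord -cardsT -(card_imset _ f_inj); apply: eq_card => c.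
rewrite inE; apply/andP/imsetP => [[/eqP c_j c_r] | [i _ ->]]; last first.
  by rewrite f_col f_row.
by exists (Ordinal c_r) => //; apply: cell_inj; rewrite ?f_col ?f_row.
Qed.

Lemma card_full_column j : #|[set c : cell | col_of c == j]| = nth 0 mu j.
Proof.
rewrite -[RHS](@card_column _ j) //; apply: eq_card => c; rewrite !inE.
by case: eqP => // <-; rewrite row_lt.
Qed.

Lemma card_cell : #|{: cell}| = N.
Proof.
rewrite card_tagged sumnE big_map big_enum /= /N sumnE (big_nth 0) big_mkord.
by apply: eq_bigr => i _; rewrite card_ord.
Qed.

Lemma card_cell_columns : #|{: cell}| = \sum_(j < K) nth 0 mu j.
Proof.
rewrite -sum1_card (partition_big (fun c => inord (col_of c) : 'I_K) predT) //=.
apply: eq_bigr => j _; rewrite -card_full_column -sum1_card.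
apply: eq_bigl => c; rewrite inE -val_eqE /= inordK //.
by rewrite ltnS ltnW // col_lt.
Qed.

Lemma sum_columns : \sum_(j < K) nth 0 mu j = sumn mu.
Proof.
by rewrite big_ord_recr /= nth_default // addn0 sumnE (big_nth 0) big_mkord.
Qed.

Lemma sumn_conj : N = sumn mu.
Proof. by rewrite -card_cell card_cell_columns sum_columns. Qed.

(* Words list the columns of the cells from the largest entry down, the last  *)
(* added cell being the head: entry v sits at position rev_ord v.             *)
Definition tableau_word T : N.-tuple 'I_K :=
  [tuple (if [pick c | T c == rev_ord u] is Some c then inord (col_of c)
          else ord0) | u < N].

Definition before T c i : nat :=
  #|[set c' : cell | (T c' < T c) && (col_of c' == i)]|.

Section Standard.

Variable T : filling.
Hypothesis T_std : is_standard T.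

Lemma std_inj : injective T.
Proof.
case/and3P: T_std => /forallP T_bij _ _ c c' Tcc'.
have /cards1P[x x_eq] := T_bij (T c).
have : c \in [set x] by rewrite -x_eq inE.
have : c' \in [set x] by rewrite -x_eq inE Tcc'.
by rewrite !inE => /eqP -> /eqP ->.
Qed.

Lemma std_row c c' : row_of c = row_of c' -> col_of c < col_of c' -> T c < T c'.
Proof.
case/and3P: T_std => _ /forallP/(_ c)/forallP/(_ c')/implyP T_row _ rr cc.
by apply: T_row; rewrite rr eqxx.
Qed.

Lemma std_col c c' : col_of c = col_of c' -> row_of c < row_of c' -> T c < T c'.
Proof.
case/and3P: T_std => _ _ /forallP/(_ c)/forallP/(_ c')/implyP T_col cc rr.
by apply: T_col; rewrite cc eqxx.
Qed.

Definition position c : 'I_N := rev_ord (T c).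

Lemma position_bij : bijective position.
Proof.
apply: inj_card_bij; last by rewrite card_ord card_cell.
by move=> c c' /rev_ord_inj/std_inj.
Qed.

Lemma tnth_tableau_word c : tnth (tableau_word T) (position c) = col_of c :> nat.
Proof.
rewrite tnth_mktuple rev_ordK; case: pickP => [c' /eqP/std_inj -> | /(_ c)].
  by rewrite inordK // ltnS ltnW ?col_lt.
by rewrite eqxx.
Qed.

Lemma after_tableau_word c i : after (tableau_word T) (position c) i = before T c i.
Proof.
rewrite /after /before -(on_card_preimset (onW_bij _ position_bij)).
apply: eq_card => c'; rewrite !inE tnth_tableau_word; congr (_ && _).
by rewrite /position /=; have := ltn_ord (T c); have := ltn_ord (T c'); rewrite /N; lia.
Qed.

(** Columns increase, so the smaller entries of the column are those above c. This lets a word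
    determine rows. *)
Lemma before_col c : before T c (col_of c) = row_of c.
Proof.
rewrite -(card_column (ltnW (row_lt c))); apply: eq_card => c'; rewrite !inE andbC.
case: eqP => //= cc; case: (ltngtP (row_of c') (row_of c)) => [|cr|rr].
- by move/(std_col cc).
- by apply/negbTE; rewrite -leqNgt ltnW // std_col.
by rewrite (cell_inj rr cc) ltnn.
Qed.

(** In column j every entry in a row above c is smaller than T c, and there are [row_of c] of them;
    removing these from the smaller entries of that column leaves the cells counted by [cstat]. *)
Lemma cstat_before c j : col_of c = j.+1 ->
  cstat T c = before T c j - before T c j.+1.
Proof.
move=> c_j; rewrite -[in before T c j.+1]c_j before_col.
have r_le : row_of c <= nth 0 mu j.
  rewrite ltnW // -ltn_count_partition // ltnW // ltn_count_partition // -c_j.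
  exact: row_lt.
rewrite /before -(cardsID [set c' : cell | row_of c' < row_of c]).
rewrite [X in X + _](_ : _ = row_of c) ?addKn.
  apply: eq_card => c'; rewrite !inE c_j eqSS -leqNgt.
  by congr (_ && _); rewrite andbC.
rewrite -[RHS](card_column r_le); apply: eq_card => c'; rewrite !inE.
case: eqP; rewrite ?andbF //= andbT => c'_j.
case: (ltnP (row_of c') (row_of c)) => rr; rewrite ?andbF // andbT.
(* Compare through the cell in the row of c' and the column of c. *)
have [c'' rr'' cc''] : {c'' : cell | row_of c'' = row_of c' & col_of c'' = j.+1}.
  by apply: cell_exists; rewrite (ltn_trans rr) // -c_j row_lt.
apply: (@ltn_trans (T c'')); first by apply: std_row; rewrite ?rr'' // c'_j cc''.
by apply: std_col; rewrite ?rr'' // cc''.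
Qed.

Lemma content_tableau_word : agree K (content (tableau_word T)) (nth 0 mu).
Proof.
apply/agreeP => i _; rewrite content_card -card_full_column.
rewrite -(on_card_preimset (onW_bij _ position_bij)).
by apply: eq_card => c; rewrite !inE tnth_tableau_word.
Qed.

Lemma ballot_weight_tableau q : ballot_weight q (tableau_word T) = cq q T.
Proof.
rewrite ballot_weight_prod /cq (reindex position) /=; last exact: onW_bij position_bij.
rewrite [RHS]big_mkcond; apply: eq_bigr => c _.
rewrite tnth_tableau_word !after_tableau_word.
by case c_j : (col_of c) => [|j] //=; rewrite (cstat_before c_j).
Qed.

End Standard.

(** The letter at a position gives the column of the cell, and the number of equal letters to its
    right gives the row. *)
Lemma tableau_word_inj : {in is_standard (lam := lam) &, injective tableau_word}.
Proof.
move=> T1 T2 std1 std2 eq_w; apply/ffunP => c; apply: rev_ord_inj.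
have [g _ gK] := position_bij std2; set c' := g (position T1 c).
have pos_c' : position T2 c' = position T1 c by rewrite gK.
suff eq_c : c = c' by move: pos_c'; rewrite -eq_c => /esym.
have cc : col_of c = col_of c'.
  by rewrite -(tnth_tableau_word std1) -(tnth_tableau_word std2) eq_w pos_c'.
apply: cell_inj => //.
by rewrite -(before_col std1) -(before_col std2) -!after_tableau_word // eq_w pos_c' cc.
Qed.

(** The inverse sends position u to the cell whose column is its letter and whose row is the number
    of equal letters to its right. *)
Lemma tableau_word_surj q w :
  agree K (content w) (nth 0 mu) -> ballot_weight q w != 0 ->
  exists2 T : filling, is_standard T & tableau_word T = w.
Proof.
move=> /agreeP w_mu; rewrite ballot_weight_prod => w_neq0.
(* Otherwise the factor at u would be [0]_q = 0. *)
have ballot u j : tnth w u = j.+1 :> nat -> after w u j.+1 < after w u j.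
  move=> wu; rewrite ltnNge; apply: contra w_neq0 => le_j.
  by rewrite (bigD1 u) //= wu /= (eqP le_j) /qnat big_ord0 mul0n.
have row_u u : after w u (tnth w u) < nth 0 mu (tnth w u).
  by rewrite -w_mu ?after_lt_content.
pose g u : cell := s2val (cell_exists (row_u u)).
have g_row u : row_of (g u) = after w u (tnth w u) by rewrite /g; case: cell_exists.
have g_col u : col_of (g u) = tnth w u by rewrite /g; case: cell_exists.
have g_inj : injective g.
  move=> u u' eq_g; have eq_w : tnth w u = tnth w u' :> nat by rewrite -!g_col eq_g.
  have eq_a : after w u (tnth w u) = after w u' (tnth w u') by rewrite -!g_row eq_g.
  apply: val_inj; case: (ltngtP u u') => // uu'.
    by have := after_lt (erefl (nat_of_ord (tnth w u'))) uu'; rewrite -eq_w eq_a eq_w ltnn.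
  by have := after_lt (erefl (nat_of_ord (tnth w u))) uu'; rewrite eq_a eq_w ltnn.
have [p gK pK] : bijective g by apply: inj_card_bij; rewrite ?card_ord ?card_cell.
pose T : filling := [ffun c => rev_ord (p c)].
have T_lt c c' : (T c < T c') = (p c' < p c).
  by rewrite !ffunE /=; have := ltn_ord (p c); have := ltn_ord (p c'); rewrite /N; lia.
have p_row c : after w (p c) (col_of c) = row_of c by rewrite -{2 3}[c]pK g_row g_col.
have p_col c : tnth w (p c) = col_of c :> nat by rewrite -{2}[c]pK g_col.
have T_std : is_standard T.
  apply/and3P; split.
  - apply/forallP => v; rewrite (_ : [set c | _] = [set g (rev_ord v)]) ?cards1 //.
    apply/setP => c; rewrite !inE ffunE.
    by rewrite -(inj_eq rev_ord_inj) rev_ordK (can2_eq pK gK).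
  - apply/forallP => c; apply/forallP => c'; apply/implyP => /andP[/eqP].
    move c'_j : (col_of c') => j; elim: j c' c'_j => // j IHj c' c'_j rr.
    rewrite ltnS leq_eqVlt => /predU1P[c_j | c_lt].
      (* In adjacent columns, [p c] has [row_of c] letters j to its right, while by [ballot] [p c']
         has more than [row_of c']; the rows being equal, [p c'] comes first. *)
      rewrite T_lt; apply: (@lt_after _ _ w _ _ j).
      by rewrite -[in after w (p c) j]c_j p_row rr -p_row c'_j ballot // p_col.
    have [c'' rr'' cc''] : {c'' : cell | row_of c'' = row_of c' & col_of c'' = j}.
      apply: cell_exists; rewrite -ltn_count_partition // ltnW //.
      by rewrite ltn_count_partition // -c'_j row_lt.
    apply: (@ltn_trans (T c'')); first by apply: IHj; rewrite ?rr''.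
    rewrite T_lt; apply: (@lt_after _ _ w _ _ j).
    by rewrite -[in after w (p c'') j]cc'' p_row rr'' -p_row c'_j ballot // p_col.
  apply/forallP => c; apply/forallP => c'; apply/implyP => /andP[/eqP cc rr].
  rewrite T_lt; apply: (@lt_after _ _ w _ _ (col_of c)).
  by rewrite p_row cc p_row.
exists T => //; apply: eq_from_tnth => u; apply: ord_inj.
have pos_u : position T (g u) = u by rewrite /position ffunE gK rev_ordK.
by rewrite -{1}pos_u tnth_tableau_word // g_col.
Qed.

Lemma sum_ballot_weight q :
  \sum_(w : N.-tuple 'I_K | agree K (content w) (nth 0 mu)) ballot_weight q w =
  b_poly lam q.
Proof.
pose S := [set T : filling | is_standard T].
transitivity (\sum_(T in S) ballot_weight q (tableau_word T)); last first.
  by apply: eq_big => T; rewrite inE // => /ballot_weight_tableau ->.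
have S_inj : {in S &, injective tableau_word}.
  by move=> T1 T2; rewrite !inE => s1 s2; apply: tableau_word_inj.
rewrite -(big_imset (fun w : N.-tuple 'I_K => ballot_weight q w) S_inj).
rewrite [LHS]big_mkcond [RHS]big_mkcond; apply: eq_bigr => w _.
case: ifP => [w_mu | w_mu]; case: imsetP => //.
  move=> w_notin; apply/eqP; apply: contra_notT w_notin.
  by move=> /(tableau_word_surj w_mu)[T std <-]; exists T; rewrite ?inE.
by case=> T; rewrite inE => std w_T; rewrite w_T content_tableau_word in w_mu.
Qed.

End Tableau.

(** * Assembling the formula *)

Theorem theorem4p8 (F : finFieldType) (n : nat) (D : 'M[F]_n) (mu : seq nat)
    (n_gt0 : 0 < n)
    (D_diag : is_diag_mx D)
    (D_distinct : injective (fun i : 'I_n => D i i))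
    (mu_partition : is_partition mu) :
  let q := #|F| in
  sigma D mu =
    'C(n, sumn mu) * (q - 1) ^ (\sum_(1 <= j < size mu) nth 0 mu j)
    * q ^ (\sum_(1 <= j < size mu) 'C(nth 0 mu j, 2))
    * b_poly (conj_part mu) q.
Proof.
move=> q; have /andP[mu_sorted _] := mu_partition.
have q_gt1 : 1 < q by apply: finNzRing_gt1.
set m := nth 0 mu 0.
have gl_gt0 : 0 < \prod_(i < m) (q ^ m - q ^ i).
  by apply: prodn_gt0 => i; rewrite subn_gt0 ltn_exp2l.
(* Multiply both sides by the number of ordered bases of W. *)
apply/eqP; rewrite -(eqn_pmul2r gl_gt0) sigma_mul_card_unitmx //; apply/eqP.
rewrite profile_countE ?(map_inj_uniq D_distinct) ?enum_uniq //; last first.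
  exact: nth_default.
rewrite size_map size_enum_ord sum_columns -!mulnA; congr (_ * _).
rewrite -(sumn_conj mu_sorted) path_weightE -(sum_ballot_weight mu_sorted).
(* Words also allow the letter [size mu], whose part is 0. *)
have drop_last (G : nat -> nat) : G 0 = 0 ->
    \sum_(1 <= j < (size mu).+1) G (nth 0 mu j) =
    \sum_(1 <= j < size mu) G (nth 0 mu j).
  move=> G0; case: (posnP (size mu)) => [-> | mu_gt0]; first by rewrite !big_geq.
  by rewrite big_nat_recr //= nth_default // G0 addn0.
rewrite -(drop_last id) // -(drop_last (binomial^~ 2)) //.
rewrite big_distrl !big_distrr; apply: eq_bigr => w /agreeP w_mu /=.
have sum_w (G : nat -> nat) : \sum_(1 <= j < (size mu).+1) G (content w j) =
    \sum_(1 <= j < (size mu).+1) G (nth 0 mu j).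
  by apply: eq_big_nat => j /andP[_ jK]; rewrite w_mu.
rewrite word_weightE ?(ltnW q_gt1) // (sum_w id) (sum_w (binomial^~ 2)) w_mu //.
rewrite -/m -/q /=; lia.
Qed.
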